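(* Let $A$ be a real constant $n\times n$ matrix, $B=A^{T}$, and let $f\colon J\to\mathbb R^n$ be continuous on an interval $J\subset\mathbb R$. Let $\lambda$ be an eigenvalue of $B$ with an elementary divisor of multiplicity $m\geq2$, corresponding to a real eigenvector $\nu^{0}$ and to real generalized eigenvectors $\nu^{k}$ of order $k$, $k=1,\dots,m-1$. Fix $t_0\in J$ and define recursively $$C_k(t)=\int_{t_0}^{t}\bigl(\nu^{k}f(\zeta)\exp(-\lambda\zeta)+k\,C_{k-1}(\zeta)\bigr)\,d\zeta\quad\text{for all }t\in J,\quad k=0,\dots,m-1$$ (the term $k\,C_{k-1}$ being $0$ for $k=0$), the first integral $$F_1(t,x)=\nu^{0}x\,\exp(-\lambda t)-C_0(t)\quad\text{for all }(t,x)\in J\times\mathbb R^n,$$ and $$F_{k+1}(t,x)=\nu^{k}x\,\exp(-\lambda t)-\sum_{\tau=0}^{k-1}\binom{k}{\tau}t^{k-\tau}F_{\tau+1}(t,x)-C_k(t)\quad\text{for all }(t,x)\in J\times\mathbb R^n,\quad k=1,\dots,m-1.$$ Then the functions $F_{k+1}$, $k=1,\dots,m-1$, are functionally independent first integrals on $J\times\mathbb R^n$ of the system $\dfrac{dx}{dt}=Ax+f(t)$.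
   Context: For a vector $\nu=(\nu_1,\dots,\nu_n)$ and $x\in\mathbb R^n$, $\nu x=\sum_{\xi=1}^n\nu_\xi x_\xi$. If $\nu^{0}$ is an eigenvector of $B$ ($B\nu^0=\lambda\nu^0$, $\nu^0\ne0$) for the eigenvalue $\lambda$ with elementary divisor of multiplicity $m$, non-zero vectors $\nu^{k}$ are called generalized eigenvectors of order $k$ if $(B-\lambda E)\nu^{k}=k\,\nu^{k-1}$, $k=1,\dots,m-1$, where $E$ is the identity matrix (vectors regarded as columns). A first integral of $dx/dt=X(t,x)$ on a domain $G'$ is a continuously differentiable function $F\colon G'\to\mathbb R$ with $\partial_tF(t,x)+\sum_{\xi=1}^nX_\xi(t,x)\,\partial_{x_\xi}F(t,x)=0$ for all $(t,x)\in G'$. *)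

(* Defs.v *)
From HB Require Import structures.
From mathcomp Require Import all_boot all_order all_algebra.
From mathcomp Require Import all_classical all_reals all_analysis.

Set Implicit Arguments.
Unset Strict Implicit.
Unset Printing Implicit Defensive.

Import Order.TTheory GRing.Theory Num.Theory.
Import numFieldNormedType.Exports.

Local Open Scope classical_set_scope.
Local Open Scope ring_scope.

(* (X - lam)^m is an elementary divisor of M: it is the exact power of X - lam
   dividing one of the invariant factors of M, i.e. one of the diagonal
   entries d of the Smith normal form of X - M over R[X]. *)
Definition elementary_divisor (R : realType) (n : nat) (M : 'M[R]_n) (lam : R)
    (m : nat) : Prop :=
  exists (P Q : 'M[{poly R}]_n) (d : 'rV[{poly R}]_n),
    [/\ P \in unitmx, Q \in unitmx,
        P *m char_poly_mx M *m Q = diag_mx d,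
        forall i j : 'I_n, (i <= j)%N -> d 0 i %| d 0 j
      & exists i : 'I_n, mup lam (d 0 i) = m].

Definition eigenvector (R : realType) (n : nat) (M : 'M[R]_n) (lam : R)
    (v : 'cV[R]_n) : Prop :=
  v != 0 /\ M *m v = lam *: v.

(* Note the factor k in the normalization of the chain. *)
Definition generalized_eigenvectors (R : realType) (n : nat) (M : 'M[R]_n)
    (lam : R) (m : nat) (nu : nat -> 'cV[R]_n) : Prop :=
  forall k : nat, (0 < k < m)%N ->
    nu k != 0 /\ (M - lam%:M) *m nu k = k%:R *: nu k.-1.

Definition dotv (R : realType) (n : nat) (v x : 'cV[R]_n) : R :=
  \sum_(i < n) v i 0 * x i 0.

(* The integral from a to b of g, for a and b in any order. *)
Definition oriented_integral (R : realType) (a b : R) (g : R -> R) : R :=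
  if a <= b then \int[lebesgue_measure]_(z in `[a, b]) g z
  else - \int[lebesgue_measure]_(z in `[b, a]) g z.

(* Points (t, x) of R x R^n are pairs of type R * 'cV[R]_n.  Derivatives are
   taken within a set G, with increments h such that a + h v stays in G.  At
   interior points of G this is 'D_v F a; at an endpoint of the interval J,
   with G = J x R^n, the time derivative is one-sided. *)
Definition diff_quotient (R : realType) (n : nat) (F : R * 'cV[R]_n -> R)
    (a v : R * 'cV[R]_n) (h : R) : R :=
  h^-1 * (F (h *: v + a) - F a).

Definition admissible (R : realType) (n : nat) (G : set (R * 'cV[R]_n))
    (a v : R * 'cV[R]_n) : set_system R :=
  within [set h : R | G (h *: v + a)] 0^'.

Definition derivable_within (R : realType) (n : nat) (G : set (R * 'cV[R]_n))
    (F : R * 'cV[R]_n -> R) (a v : R * 'cV[R]_n) : Prop :=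
  cvg (diff_quotient F a v @ admissible G a v).

Definition derive_within (R : realType) (n : nat) (G : set (R * 'cV[R]_n))
    (F : R * 'cV[R]_n -> R) (v a : R * 'cV[R]_n) : R :=
  lim (diff_quotient F a v @ admissible G a v).

Definition t_dir (R : realType) (n : nat) : R * 'cV[R]_n := (1, 0).
Definition x_dir (R : realType) (n : nat) (i : 'I_n) : R * 'cV[R]_n :=
  (0, delta_mx i 0).
Arguments t_dir {R n}.
Arguments x_dir {R n} i.

Definition continuously_differentiable (R : realType) (n : nat)
    (G : set (R * 'cV[R]_n)) (F : R * 'cV[R]_n -> R) : Prop :=
  forall v : R * 'cV[R]_n, v = t_dir \/ (exists i : 'I_n, v = x_dir i) ->
    (forall a, G a -> derivable_within G F a v) /\
    {within G, continuous (derive_within G F v)}.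

(* First integral on G of the system dx/dt = X(t, x). *)
Definition first_integral (R : realType) (n : nat) (G : set (R * 'cV[R]_n))
    (X : R * 'cV[R]_n -> 'cV[R]_n) (F : R * 'cV[R]_n -> R) : Prop :=
  continuously_differentiable G F /\
  forall p, G p ->
    derive_within G F t_dir p
    + \sum_(i < n) X p i 0 * derive_within G F (x_dir i) p = 0.

Definition jacobian_within (R : realType) (n r : nat)
    (G : set (R * 'cV[R]_n)) (F : 'I_r -> R * 'cV[R]_n -> R)
    (p : R * 'cV[R]_n) : 'M[R]_(r, 1 + n) :=
  row_mx (\col_(j < r) derive_within G (F j) t_dir p)
         (\matrix_(j < r, i < n) derive_within G (F j) (x_dir i) p).

(* Both usual meanings of functional independence are required: the Jacobian
   matrix has full rank r at every point of G; and on no nonempty relatively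
   open part of G is there a relation Phi(F_1, ..., F_r) = 0 with Phi
   continuous and not identically zero on any nonempty open set.  (For C^1
   functions on an open G the first condition implies the second.) *)
Definition functionally_independent (R : realType) (n r : nat)
    (G : set (R * 'cV[R]_n)) (F : 'I_r -> R * 'cV[R]_n -> R) : Prop :=
  (forall p, G p -> \rank (jacobian_within G F p) = r) /\
  (forall (U : set (R * 'cV[R]_n)) (Phi : 'rV[R]_r -> R),
     open U -> U `&` G !=set0 ->
     continuous Phi -> dense [set y | Phi y != 0] ->
     exists2 p, (U `&` G) p & Phi (\row_(j < r) F j p) != 0).

(* Main.v *)
(* Put y_k(t, x) = nu^k x exp(- lam t) - C_k(t).  Along solutions the derivative
   of y_k is k y_(k-1), and the recursion for the F's inverts to
   F_(k+1) = sum_i binom(k, i) (- t)^(k - i) y_i, so differentiating the binomial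
   coefficients cancels the derivatives of the y_i.  At fixed t the
   F_(k+1) are affine in x, with gradients
   w_k(t) = exp(- lam t) sum_i binom(k, i) (- t)^(k - i) nu^i.  These again form a
   Jordan chain, (A^T - lam) w_k = k w_(k-1), hence are linearly independent; the
   map x |-> (F_2, ..., F_m)(t, x) then has a continuous affine right inverse,
   which rules out any relation Phi(F_2, ..., F_m) = 0. *)
Require Import Defs.
From HB Require Import structures.
From mathcomp Require Import all_boot all_order all_algebra.
From mathcomp Require Import all_classical all_reals all_analysis.
From mathcomp Require Import lra ring zify.

Set Implicit Arguments.
Unset Strict Implicit.
Unset Printing Implicit Defensive.

Import Order.TTheory GRing.Theory Num.Theory.
Import numFieldNormedType.Exports.

Local Open Scope classical_set_scope.
Local Open Scope ring_scope.

(** * Binomial transforms and linear independence of Jordan chains *)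

(** For i > k the truncated exponent is 0, but the binomial coefficient vanishes, so sums may run
    over all i < m whatever k < m is. *)
Definition btrans (R : comNzRingType) (t : R) (k i : nat) : R :=
  'C(k, i)%:R * (- t) ^+ (k - i).

Lemma coef_XsubC_exp (R : comNzRingType) (t : R) k i :
  (('X - t%:P) ^+ k)`_i = btrans t k i.
Proof.
rewrite /btrans; elim: k i => [|k IH] i.
  by rewrite expr0 coef1 bin0n sub0n expr0 mulr1.
rewrite exprS mulrBl coefB coefXM coefCM !IH.
case: i => [|i] /=; first by rewrite !bin0 !subn0 exprS sub0r !mul1r mulNr.
rewrite binS natrD mulrDl subSS [RHS]addrC; congr (_ + _).
have [ik|ki] := ltnP i k; last by rewrite bin_small ?ltnS// !mul0r mulr0 oppr0.
by rewrite -(subnSK ik) exprS [RHS]mulrCA mulNr.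
Qed.

(* With L the linear form on polynomials sending 'X^i to y i, the recursion
   says that a k = L (('X - t)^k). *)
Lemma binomial_inversion (R : comNzRingType) (t : R) (y a : nat -> R) (m : nat) :
  (forall k, (k < m)%N ->
    a k = y k - \sum_(0 <= i < k) 'C(k, i)%:R * t ^+ (k - i) * a i) ->
  forall k, (k < m)%N -> a k = \sum_(i < m) btrans t k i * y i.
Proof.
move=> ha.
pose L (p : {poly R}) := \sum_(i < m) p`_i * y i.
have LD : {morph L : p q / p + q}.
  by move=> p q; rewrite -big_split; apply: eq_bigr => i _; rewrite coefD mulrDl.
have L0 : L 0 = 0 by rewrite /L big1// => i _; rewrite coef0 mul0r.
have LZ c p : L (c *: p) = c * L p.
  by rewrite /L mulr_sumr; apply: eq_bigr => i _; rewrite coefZ mulrA.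
suff aL k : (k < m)%N -> a k = L (('X - t%:P) ^+ k).
  move=> k km; rewrite aL//.
  by apply: eq_bigr => i _; rewrite coef_XsubC_exp.
elim/ltn_ind: k => k IH km.
have yL : y k = L 'X^k.
  rewrite /L (bigD1 (Ordinal km))//= coefXn eqxx mul1r big1 ?addr0// => i ik.
  by rewrite coefXn (negbTE (_ : val i != k)) ?mul0r.
(* This is the binomial expansion of X = t + (X - t). Solved for its top term (X - t)^k, it has the
   shape of the recursion for [a k]. *)
have XE : 'X^k = \sum_(i < k) ('C(k, i)%:R * t ^+ (k - i)) *: ('X - t%:P) ^+ i
                 + ('X - t%:P) ^+ k.
  rewrite -{1}(subrK (t%:P) 'X) addrC exprDn big_ord_recr /= subnn expr0 mul1r.
  rewrite binn; congr (_ + _); apply: eq_bigr => i _.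
  by rewrite -polyC_exp mul_polyC -scaler_nat scalerA.
rewrite ha// yL XE LD (big_morph L LD L0) big_mkord addrAC -sumrB big1 ?add0r//.
by move=> i _; rewrite LZ -IH ?subrr// (ltn_trans _ km).
Qed.

(** Reindexing by i -> i + 1 reduces this to the absorption identity i C(k, i) = k C(k - 1, i - 1);
    the last term on the right vanishes because k < m. Values in a module allow both scalar
    functions and chain vectors for [u]. *)
Lemma btrans_shift (R : comNzRingType) (V : lmodType R) (t : R) (u : nat -> V) k m :
  (k < m)%N ->
  \sum_(i < m) (btrans t k i * i%:R) *: u i.-1 =
  \sum_(i < m) (k%:R * btrans t k.-1 i) *: u i.
Proof.
case: m => // m km.
rewrite big_ord_recl mulr0 scale0r add0r big_ord_recr /=.
have [k0|k0] := posnP k.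
  rewrite k0 !mul0r !scale0r addr0; apply: eq_bigr => i _.
  by rewrite /btrans bin0n !mul0r !scale0r.
rewrite /btrans (@bin_small k.-1) ?mul0r ?mulr0 ?scale0r ?addr0; last by rewrite prednK.
apply: eq_bigr => i _; rewrite /bump /= add1n; congr (_ *: _).
case: k km k0 => // k km _ /=.
by rewrite subSS mulrAC !mulrA -!natrM mulnC -mul_bin_diag.
Qed.

(** Applying N to a relation kills the [v 0] term and leaves a relation on a chain shorter by one,
    with coefficients a (i + 1) c (i + 1). By induction these vanish, and only a 0 *: v 0 = 0
    remains. *)
Lemma chain_coef_eq0 (K : fieldType) n (N : 'M[K]_n) (c : nat -> K)
    (v : nat -> 'cV[K]_n) m (a : nat -> K) :
  v 0%N != 0 -> N *m v 0%N = 0 ->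
  (forall k, (0 < k < m)%N -> c k != 0 /\ N *m v k = c k *: v k.-1) ->
  \sum_(k < m) a k *: v k = 0 -> forall k, (k < m)%N -> a k = 0.
Proof.
move=> v0 Nv0; elim: m a => // m IH a Nv s0 k.
have aS i : (i < m)%N -> a i.+1 = 0.
  move=> im; have [|ci _] := Nv i.+1; first by rewrite ltnS.
  apply: (mulIf ci); rewrite mul0r.
  apply: (IH (fun i => a i.+1 * c i.+1)) => //.
    by move=> j /andP[j0 jm]; apply: Nv; rewrite j0 ltnW.
  have := congr1 (mulmx N) s0; rewrite mulmx_sumr mulmx0 big_ord_recl.
  rewrite -scalemxAr Nv0 scaler0 add0r => {2}<-.
  apply: eq_bigr => j _; rewrite -scalemxAr lift0.
  by have [|_ ->] := Nv j.+1; rewrite ?scalerA //= ltnS ltn_ord.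
case: k => [_|k /aS//].
move: s0; rewrite big_ord_recl big1 => [|i _]; last by rewrite lift0 aS ?scale0r.
by rewrite addr0 => /eqP; rewrite scaler_eq0 (negbTE v0) orbF => /eqP.
Qed.

(** * Calculus of derivatives within a set *)

(* Encoded by a local extension differentiable at s, so that the two-sided
   calculus rules also serve at endpoints of D. *)
Definition is_derive_in (R : realType) (D : set R) (s : R) (c : R -> R) (d : R) :=
  exists2 H : R -> R, is_derive s 1 H d & \forall z \near s, D z -> c z = H z.

Section is_derive_in.
Context {R : realType} (D : set R) (s : R).
Implicit Types (c : R -> R) (d : R).

Lemma is_derive_is_derive_in c d : is_derive s 1 c d -> is_derive_in D s c d.
Proof. by move=> cd; exists c => //; exact: filterE. Qed.

Lemma is_derive_inD c1 c2 d1 d2 :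
  is_derive_in D s c1 d1 -> is_derive_in D s c2 d2 ->
  is_derive_in D s (fun z => c1 z + c2 z) (d1 + d2).
Proof.
move=> [H1 dH1 e1] [H2 dH2 e2]; exists (H1 + H2); first exact: is_deriveD.
by apply: filterS2 e1 e2 => z h1 h2 Dz; rewrite h1// h2.
Qed.

Lemma is_derive_inM c1 c2 d1 d2 : D s ->
  is_derive_in D s c1 d1 -> is_derive_in D s c2 d2 ->
  is_derive_in D s (fun z => c1 z * c2 z) (d1 * c2 s + c1 s * d2).
Proof.
move=> Ds [H1 dH1 e1] [H2 dH2 e2]; exists (H1 * H2).
  apply: is_derive_eq; rewrite (nbhs_singleton e1 Ds) (nbhs_singleton e2 Ds).
  by rewrite addrC /GRing.scale/= mulrC.
by apply: filterS2 e1 e2 => z h1 h2 Dz; rewrite h1// h2.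
Qed.

Lemma is_derive_in_sum m (c : 'I_m -> R -> R) (d : 'I_m -> R) :
  (forall i, is_derive_in D s (c i) (d i)) ->
  is_derive_in D s (fun z => \sum_(i < m) c i z) (\sum_(i < m) d i).
Proof.
elim: m c d => [|m IH] c d cd.
  exists (cst 0); first by rewrite big_ord0; exact: is_derive_cst.
  by apply: filterE => z _; rewrite big_ord0.
under eq_fun do rewrite big_ord_recl.
by rewrite big_ord_recl; apply: is_derive_inD => //; exact: IH.
Qed.

Lemma eq_is_derive_in c1 c2 d : (forall z, D z -> c1 z = c2 z) ->
  is_derive_in D s c1 d -> is_derive_in D s c2 d.
Proof.
move=> c12 [H dH e]; exists H => //.
by apply: filterS e => z + Dz; rewrite -c12//; apply.
Qed.

Lemma is_derive_in_cvg c d : D s -> is_derive_in D s c d ->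
  c z @[z --> within D (nbhs s)] --> c s.
Proof.
move=> Ds [H [dH _] e]; rewrite (nbhs_singleton e Ds).
have : H z @[z --> within D (nbhs s)] --> H s.
  by apply: cvg_within_filter; apply: differentiable_continuous; exact/derivable1_diffP.
apply: cvg_trans; apply: near_eq_cvg; rewrite /within/=.
by apply: filterS e => z /[apply].
Qed.

(** The link with the one-sided quotients of [derive_within]: near 0 the quotient of [c] agrees with
    that of its extension, whose two-sided limit restricts to admissible increments. *)
Lemma is_derive_in_quotient c d : D s -> is_derive_in D s c d ->
  h^-1 * (c (h + s) - c s) @[h --> within [set h | D (h + s)] 0^'] --> d.
Proof.
move=> Ds [H [dH dHE] e]; rewrite (nbhs_singleton e Ds).
have : h^-1 * (H (h + s) - H s) @[h --> within [set h | D (h + s)] 0^'] --> d.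
  apply: cvg_within_filter.
  rewrite -dHE /derive.
  have <- : (fun h => h^-1 *: ((H \o shift s) (h *: (1 : R)) - H s)) =
      (fun h => h^-1 * (H (h + s) - H s)).
    by apply/funext => h; rewrite /= /GRing.scale/= mulr1.
  exact: dH.
apply: cvg_trans; apply: near_eq_cvg; rewrite /within/=.
move/(nbhs0P (fun z => D z -> c z = H z))/nbhs_dnbhs : e.
by apply: filterS => h + Dh; rewrite [s + h]addrC => ->.
Qed.

End is_derive_in.

(** * Primitives of continuous functions on an interval *)

Lemma oriented_integral_primitive (R : realType) (g : R -> R) (a b : R) :
  a <= b -> {within `[a, b], continuous g} ->
  exists H : R -> R,
    (forall u v, u \in `[a, b] -> v \in `[a, b] ->
       oriented_integral u v g = H v - H u) /\
    (forall s, s \in `[a, b] -> is_derive s 1 H (g s)).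
Proof.
move=> ab gc.
(* Freezing g at its endpoint values gives a continuous function on the whole line, so the
   fundamental theorem yields a two-sided derivative even at a and b. *)
pose g' z := g (Num.max a (Num.min b z)).
have g'E z : z \in `[a, b] -> g' z = g z.
  by rewrite in_itv/= => /andP[az zb]; rewrite /g' (min_r zb) (max_r az).
have g'c : continuous g'.
  move=> z A /=.
  set p := Num.max a (Num.min b z) => gA.
  have pab : p \in `[a, b] by rewrite in_itv/= le_max lexx ge_max ab ge_min lexx.
  have /subspace_continuousP/(_ p pab) := gc.
  move=> /(_ A gA); rewrite /within/=.
  have : (fun z => Num.max a (Num.min b z)) @ z --> p.
    apply: (@continuous_max _ _ (cst a) (fun z => Num.min b z)); first exact: cvg_cst.
    apply: (@continuous_min _ _ (cst b) id); first exact: cvg_cst.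
    exact: cvg_id.
  move=> /[apply] hx; apply: (@filterS _ (nbhs z)) hx => x; rewrite /g' /=; apply.
  by rewrite in_itv/= le_max lexx ge_max ab ge_min lexx.
have g'i u v : lebesgue_measure.-integrable `[u, v] (EFin \o g').
  apply: continuous_compact_integrable; first exact: segment_compact.
  exact: continuous_subspaceT.
(* Starting at a - 1 rather than a keeps every s in [a, b], including a itself, strictly inside the
   interval of integration used below. *)
pose H s := \int[lebesgue_measure]_(z in `[a - 1, s]) g' z.
have HB u v : a <= u -> u <= v -> v <= b ->
    \int[lebesgue_measure]_(z in `[u, v]) g z = H v - H u.
  move=> au uv vb; rewrite /H.
  rewrite Rintegral_itvB; [|exact: g'i|..]; last 2 first.
  - by rewrite bnd_simp; lra.
  - by rewrite bnd_simp.
  rewrite Rintegral_itv_obnd_cbnd; last first.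
    apply: integrableS (g'i u v) => //; exact: subset_itv_oc_cc.
  apply: eq_Rintegral => z; rewrite inE/= in_itv/= => /andP[uz zv].
  by rewrite g'E// in_itv/= (le_trans au)// (le_trans zv).
exists H; split.
  move=> u v; rewrite !in_itv/= /oriented_integral => /andP[au ub] /andP[av vb].
  case: ifPn => [uv|]; first exact: HB.
  by rewrite -ltNge => /ltW vu; rewrite HB// opprB.
move=> s sab; move: (sab); rewrite in_itv/= => /andP[as_ sb].
have [] := @continuous_FTC1 R g' (BLeft (a - 1)) s (s + 1) _ (g'i _ _) _ (g'c s).
- by rewrite ltrDl.
- by rewrite lte_fin; lra.
by move=> dH HE; apply: DeriveDef => //; rewrite -derive1E HE g'E.
Qed.

(** J may be open, closed or unbounded, so the compact case is applied to some [a, b] in J that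
    contains t0, s and all points of J close to s. *)
Lemma oriented_integral_is_derive_in (R : realType) (J : interval R)
    (g c : R -> R) (t0 : R) : t0 \in J ->
  {within [set` J], continuous g} ->
  (forall t, t \in J -> c t = oriented_integral t0 t g) ->
  forall s, s \in J -> is_derive_in [set` J] s c (g s).
Proof.
move=> t0J gc cE s sJ.
(* If J has a point p < s, then a = min(p, t0) works; otherwise s is the least element of J and a =
   min(s, t0) does. *)
have [a [aJ [at0 as_] an]] : exists a, [/\ a \in J, a <= t0 /\ a <= s &
    \forall z \near s, z \in J -> a <= z].
  have [[p [pJ ps]]|np] := pselect (exists p, p \in J /\ p < s).
    exists (Num.min p t0); split; first by case: (leP p t0).
      by rewrite ge_min lexx orbT ge_min (ltW ps).
    near=> z => _; rewrite ge_min; apply/orP; left; apply: ltW.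
    by near: z; exact: lt_nbhsr.
  exists (Num.min s t0); split; first by case: (leP s t0).
    by rewrite !ge_min !lexx orbT.
  apply: filterE => z zJ; rewrite ge_min; apply/orP; left.
  by rewrite leNgt; apply/negP => zs; apply: np; exists z.
have [b [bJ [t0b sb] bn]] : exists b, [/\ b \in J, t0 <= b /\ s <= b &
    \forall z \near s, z \in J -> z <= b].
  have [[p [pJ ps]]|np] := pselect (exists p, p \in J /\ s < p).
    exists (Num.max p t0); split; first by case: (leP p t0).
      by rewrite le_max lexx orbT le_max (ltW ps).
    near=> z => _; rewrite le_max; apply/orP; left; apply: ltW.
    by near: z; exact: lt_nbhsl.
  exists (Num.max s t0); split; first by case: (leP s t0).
    by rewrite !le_max !lexx orbT.
  apply: filterE => z zJ; rewrite le_max; apply/orP; left.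
  by rewrite leNgt; apply/negP => zs; apply: np; exists z.
have abJ : `[a, b] `<=` [set` J].
  move=> z; rewrite /= in_itv/= => zab.
  exact: (@interval_is_interval _ J a b).
have [||H [HE dH]] := @oriented_integral_primitive R g a b.
- exact: le_trans sb.
- exact: continuous_subspaceW gc.
exists (H - cst (H t0)).
  apply: is_derive_eq; first apply: is_deriveB; first apply: dH.
    by rewrite in_itv/= as_ sb.
  by rewrite subr0.
near=> z => zJ; rewrite cE// HE// in_itv/= ?at0 ?t0b//.
by rewrite (near an z)// (near bn z).
Unshelve. all: by end_near. Qed.

(** * Time derivatives of binomial sums *)

Lemma is_derive_btrans (R : realType) (s : R) k i :
  is_derive s 1 (fun t => btrans t k i) (- (k%:R * btrans s k.-1 i)).
Proof.
have -> : (fun t : R => btrans t k i) =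
    ('C(k, i)%:R : R) \*: ((- (@id R)) ^+ (k - i)).
  by apply/funext => t; rewrite /btrans /GRing.scale/= exprfctE.
apply: is_derive_eq.
(* The identity behind the formula is (k - i) C(k, i) = k C(k - 1, i); at k = 0 the factor k
   neutralizes [k.-1]. *)
rewrite /btrans mulrA -natrM mul_bin_down natrM -subnS -addn1 addnC subnDA subn1.
rewrite /GRing.scale/= !fctE /=; ring.
Qed.

(* The terms i * u (i - 1) of the derivatives of the u i cancel against the
   derivatives of the coefficients. *)
Lemma is_derive_in_btrans_sum (R : realType) (D : set R) (s : R)
    (u : nat -> R -> R) (e : nat -> R) m k : D s -> (k < m)%N ->
  (forall i, (i < m)%N -> is_derive_in D s (u i) (e i + i%:R * u i.-1 s)) ->
  is_derive_in D s (fun t => \sum_(i < m) btrans t k i * u i t)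
    (\sum_(i < m) btrans s k i * e i).
Proof.
move=> Ds km du.
have -> : \sum_(i < m) btrans s k i * e i = \sum_(i < m)
    (- (k%:R * btrans s k.-1 i) * u i s + btrans s k i * (e i + i%:R * u i.-1 s)).
  have := @btrans_shift R R^o s (fun i => u i s) k m km; rewrite /GRing.scale/= => sh.
  transitivity (\sum_(i < m) btrans s k i * e i
      + (\sum_(i < m) btrans s k i * i%:R * u i.-1 s
      - \sum_(i < m) k%:R * btrans s k.-1 i * u i s)).
    by rewrite sh subrr addr0.
  by rewrite -sumrB -big_split; apply: eq_bigr => i _ /=; ring.
apply: is_derive_in_sum => i; apply: is_derive_inM => //; last exact: du.
exact/is_derive_is_derive_in/is_derive_btrans.
Qed.

(** * Algebra and continuity of the pairing *)

Lemma dotv_suml (R : realType) n m (c : 'I_m -> R) (v : 'I_m -> 'cV[R]_n) x :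
  dotv (\sum_(i < m) c i *: v i) x = \sum_(i < m) c i * dotv (v i) x.
Proof.
under [RHS]eq_bigr do rewrite mulr_sumr.
rewrite exchange_big; apply: eq_bigr => j _.
by rewrite summxE mulr_suml; apply: eq_bigr => i _; rewrite mxE mulrA.
Qed.

Lemma dotvDl (R : realType) n (u v x : 'cV[R]_n) : dotv (u + v) x = dotv u x + dotv v x.
Proof. by rewrite -big_split; apply: eq_bigr => i _; rewrite mxE mulrDl. Qed.

Lemma dotvZl (R : realType) n c (v x : 'cV[R]_n) : dotv (c *: v) x = c * dotv v x.
Proof. by rewrite /dotv mulr_sumr; apply: eq_bigr => i _; rewrite mxE mulrA. Qed.

Lemma dotvDr (R : realType) n (v x y : 'cV[R]_n) : dotv v (x + y) = dotv v x + dotv v y.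
Proof. by rewrite -big_split; apply: eq_bigr => i _; rewrite mxE mulrDr. Qed.

Lemma dotvZr (R : realType) n c (v x : 'cV[R]_n) : dotv v (c *: x) = c * dotv v x.
Proof. by rewrite /dotv mulr_sumr; apply: eq_bigr => i _; rewrite mxE mulrCA. Qed.

Lemma dotv_delta (R : realType) n (v : 'cV[R]_n) i : dotv v (delta_mx i 0) = v i 0.
Proof.
rewrite /dotv (bigD1 i)//= mxE !eqxx mulr1 big1 ?addr0// => j ji.
by rewrite mxE (negbTE ji) mulr0.
Qed.

Lemma dotvE (R : realType) n (v x : 'cV[R]_n) : dotv v x = (v^T *m x) 0 0.
Proof. by rewrite mxE; apply: eq_bigr => i _; rewrite mxE. Qed.

Lemma dotv_mulmx (R : realType) n (A : 'M[R]_n) (v x : 'cV[R]_n) :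
  dotv v (A *m x) = dotv (A^T *m v) x.
Proof. by rewrite !dotvE trmx_mul trmxK mulmxA. Qed.

Lemma cvg_dotv (R : realType) n {T : Type} (F : set_system T) {FF : Filter F}
    (u v : T -> 'cV[R]_n) (u0 v0 : 'cV[R]_n) :
  (forall i, u z i 0 @[z --> F] --> u0 i 0) ->
  (forall i, v z i 0 @[z --> F] --> v0 i 0) ->
  dotv (u z) (v z) @[z --> F] --> dotv u0 v0.
Proof.
move=> uu0 vv0; apply: cvg_big => [|i _]; first exact: add_continuous.
exact: cvgM.
Qed.

(** * First integrals on the strip that are affine in x *)

Section strip.
Context {R : realType} {n : nat} (J : interval R)
  (hJ : exists a b : R, [/\ a \in J, b \in J & a < b]).
Let G := [set p : R * 'cV[R]_n | p.1 \in J].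

Lemma admissible_t_dir t x :
  admissible G (t, x) t_dir = within [set h | [set` J] (h + t)] 0^'.
Proof.
rewrite /admissible.
suff -> : [set h | G (h *: t_dir + (t, x))] = [set h | [set` J] (h + t)] by [].
by apply/funext => h; rewrite /G /t_dir/= /GRing.scale/= mulr1.
Qed.

Lemma admissible_x_dir t x i : t \in J -> admissible G (t, x) (x_dir i) = 0^'.
Proof.
move=> tJ; rewrite /admissible.
suff -> : [set h | G (h *: x_dir i + (t, x))] = setT.
  apply/funext => P; apply/propext; split; last exact: cvg_within.
  by rewrite /within/=; apply: filterS => h; apply.
by apply/seteqP; split => // h _; rewrite /G/= /GRing.scale/= mulr0 add0r.
Qed.

(** This makes limits of difference quotients unique. In the time direction it rests on J having a
    second point c: small steps from t towards c stay in J by convexity. *)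
Lemma admissible_proper p v : G p -> v = t_dir \/ (exists i, v = x_dir i) ->
  ProperFilter (admissible G p v).
Proof.
case: p => t x /= tJ [->|[i ->]]; last first.
  by rewrite admissible_x_dir//; exact: Proper_dnbhs_numFieldType.
rewrite admissible_t_dir.
apply: Build_ProperFilter_ex => P.
have [c [cJ ct]] : exists c, c \in J /\ c != t.
  have [a [b [aJ bJ ab]]] := hJ.
  have [at_|] := eqVneq a t; last by exists a.
  by exists b; rewrite -at_ gt_eqF.
rewrite /within/= => /nbhs_ballP[e /= e0 eP].
have ct0 : 0 < `|c - t| by rewrite normr_gt0 subr_eq0.
(* The bound 1 keeps t + s (c - t) between t and c; the other bound makes the increment smaller than
   e. *)
pose s := Num.min 1 (e / (2 * `|c - t|)).
have s0 : 0 < s by rewrite /s lt_min ltr01 divr_gt0// mulr_gt0.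
have s1 : s <= 1 by rewrite /s ge_min lexx.
have se : s * `|c - t| < e.
  apply: (@le_lt_trans _ _ (e / 2)); last by lra.
  by rewrite -ler_pdivlMr// -mulrA -invfM /s ge_min lexx orbT.
exists (s * (c - t)); apply: eP.
- by rewrite /ball/= sub0r normrN normrM gtr0_norm.
- by rewrite mulf_eq0 negb_or gt_eqF//= subr_eq0.
- rewrite /=; have [tc|tc] := ltP t c.
    apply: (@interval_is_interval _ J t c) => //; nra.
  apply: (@interval_is_interval _ J c t) => //; nra.
Qed.

Lemma derive_withinE F p v l : G p -> v = t_dir \/ (exists i, v = x_dir i) ->
  diff_quotient F p v @ admissible G p v --> l ->
  derivable_within G F p v /\ derive_within G F v p = l.
Proof.
move=> Gp hv dl; have PF := admissible_proper Gp hv.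
by split; [apply/cvg_ex; exists l|apply/cvg_lim].
Qed.

(** The gradient in x is w(t), so the assumed time derivative is exactly the first integral
    equation; the work lies in the continuity of the partial derivatives. The second conclusion
    supplies the entries of the Jacobian. *)
Lemma affine_first_integral (A : 'M[R]_n) (f : R -> 'cV[R]_n)
    (F : R * 'cV[R]_n -> R) (w : R -> 'cV[R]_n) (c : R -> R) :
  {within [set` J], continuous f} ->
  (forall i, continuous (fun t => w t i 0)) ->
  (forall t x, t \in J -> F (t, x) = dotv (w t) x + c t) ->
  (forall t x, t \in J -> is_derive_in [set` J] t (fun z => F (z, x))
     (- dotv (w t) (A *m x + f t))) ->
  first_integral G (fun p => A *m p.2 + f p.1) F /\
  forall p i, G p -> derive_within G F (x_dir i) p = w p.1 i 0.
Proof.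
move=> hf hw hF hd.
have dt p : G p -> derivable_within G F p t_dir /\
    derive_within G F t_dir p = - dotv (w p.1) (A *m p.2 + f p.1).
  case: p => t x tJ; apply: derive_withinE => //; first by left.
  rewrite admissible_t_dir.
  have := is_derive_in_quotient tJ (hd t x tJ).
  apply: cvg_trans; apply: near_eq_cvg; apply: nearW => h.
  rewrite /diff_quotient; congr (_ * (F _ - _)).
  by congr pair; rewrite /= ?scaler0 ?add0r// /GRing.scale/= mulr1.
have dx p i : G p -> derivable_within G F p (x_dir i) /\
    derive_within G F (x_dir i) p = w p.1 i 0.
  case: p => t x tJ; apply: derive_withinE => //; first by right; exists i.
  rewrite admissible_x_dir//.
  apply: cvg_near_cst; near=> h.
  have h0 : h != 0 by near: h; exact: nbhs_dnbhs_neq.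
  rewrite /diff_quotient.
  have -> : h *: x_dir i + (t, x) = (t, h *: delta_mx i 0 + x).
    by congr pair; rewrite /= /GRing.scale/= mulr0 add0r.
  rewrite !hF// dotvDr dotvZr dotv_delta /=.
  by field.
have fst_w (p : R * 'cV[R]_n) i : w q.1 i 0 @[q --> within G (nbhs p)] --> w p.1 i 0.
  apply: cvg_within_filter.
  have pfst : q.1 @[q --> nbhs p] --> nbhs p.1  by exact: cvg_fst.
  exact: (cvg_comp _ _ pfst (hw i p.1)).
split; last by move=> p i Gp; exact: (dx p i Gp).2.
split; last first.
  move=> p Gp; rewrite (dt p Gp).2
      (eq_bigr (fun i => w p.1 i 0 * (A *m p.2 + f p.1) i 0)).
    by rewrite addNr.
  by move=> i _; rewrite (dx p i Gp).2 mulrC.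
move=> v [->|[i ->]]; split.
- by move=> a Ga; exact: (dt a Ga).1.
- apply/subspace_continuousP => p Gp; rewrite /from_subspace (dt p Gp).2.
  have : - dotv (w q.1) (A *m q.2 + f q.1) @[q --> within G (nbhs p)] -->
      - dotv (w p.1) (A *m p.2 + f p.1).
    apply: cvgN; apply: cvg_dotv => i; first exact: fst_w.
    under eq_fun do rewrite mxE; rewrite mxE.
    apply: cvgD.
      under eq_fun do rewrite mxE; rewrite mxE.
      apply: cvg_big => [|j _]; first exact: add_continuous.
      apply: cvgM; first exact: cvg_cst.
      apply: cvg_within_filter.
      have psnd : q.2 @[q --> nbhs p] --> nbhs p.2 by exact: cvg_snd.
      exact: (@cvg_comp _ _ _ snd (fun v : 'cV[R]_n => v j 0) _ _ _ psnd
        (@coord_continuous _ _ _ j 0 _)).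
    (* Since f is continuous only relative to J, the projection has to carry the filter within G to
       the filter within J. *)
    have fstG : q.1 @[q --> within G (nbhs p)] --> within [set` J] (nbhs p.1).
      move=> P; rewrite /within/= => hP.
      exact: (@cvg_fst _ _ (nbhs p.1) (nbhs p.2) _ _ hP).
    apply: (@cvg_comp _ _ _ fst (fun t => f t i 0) _ _ _ fstG).
    have /subspace_continuousP/(_ p.1 Gp) fp := hf.
    exact: (@cvg_comp _ _ _ f (fun v : 'cV[R]_n => v i 0) _ _ _ fp
      (@coord_continuous _ _ _ i 0 _)).
  apply: cvg_trans; apply: near_eq_cvg; rewrite /within/=.
  by apply: (@filterE _ (nbhs p)) => q Gq; rewrite (dt q Gq).2.
- by move=> a Ga; exact: (dx a i Ga).1.
- apply/subspace_continuousP => p Gp; rewrite /from_subspace (dx p i Gp).2.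
  have := fst_w p i.
  apply: cvg_trans; apply: near_eq_cvg; rewrite /within/=.
  by apply: (@filterE _ (nbhs p)) => q Gq; rewrite (dx q i Gq).2.
Unshelve. all: by end_near. Qed.
End strip.

(** * Functional independence *)

Lemma chain_row_free (K : fieldType) n (N : 'M[K]_n) (c : nat -> K)
    (v : nat -> 'cV[K]_n) r :
  v 0%N != 0 -> N *m v 0%N = 0 ->
  (forall k, (0 < k <= r)%N -> c k != 0 /\ N *m v k = c k *: v k.-1) ->
  row_free (\matrix_(j < r, i < n) v j.+1 i 0).
Proof.
move=> v0 Nv0 Nv; apply: inj_row_free => u uL.
(* The rows are v 1, ..., v r; a relation among them is padded with coefficient 0 at [v 0] to become
   one on the full chain. *)
pose a k := if k is k'.+1 then oapp (u 0) 0 (insub k' : option 'I_r) else 0.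
have s0 : \sum_(k < r.+1) a k *: v k = 0.
  rewrite big_ord_recl scale0r add0r; apply/colP => i.
  have /rowP/(_ i) := uL; rewrite !mxE summxE => uLi; rewrite -[RHS]uLi.
  by apply: eq_bigr => j _; rewrite lift0 /= valK !mxE.
apply/rowP => j; rewrite mxE.
have := @chain_coef_eq0 _ _ N c v r.+1 a v0 Nv0 Nv s0 j.+1.
by rewrite ltnS ltn_ord /= valK => /(_ isT).
Qed.

Lemma continuous_btrans (R : realType) k i : continuous (fun t : R => btrans t k i).
Proof.
move=> t; apply: differentiable_continuous; apply/derivable1_diffP.
by have [] := is_derive_btrans t k i.
Qed.

(** A right inverse N of the gradient matrix serves both halves: padded with a zero row it inverts
    the whole Jacobian on the right, and it defines the affine section [g] of the map x |-> F(t,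
    x). *)
Lemma strip_functionally_independent (R : realType) n (J : interval R) r
    (F : 'I_r -> R * 'cV[R]_n -> R) (w : 'I_r -> R -> 'cV[R]_n)
    (c : 'I_r -> R -> R) :
  let G := [set p : R * 'cV[R]_n | p.1 \in J] in
  (forall j t x, t \in J -> F j (t, x) = dotv (w j t) x + c j t) ->
  (forall j p i, G p -> derive_within G (F j) (x_dir i) p = w j p.1 i 0) ->
  (forall t, t \in J -> row_free (\matrix_(j < r, i < n) w j t i 0)) ->
  functionally_independent G F.
Proof.
move=> G hF hd free; split.
  move=> p Gp; apply/eqP; have /row_freeP[N LN] := free _ Gp.
  apply/row_freeP; exists (col_mx 0 N).
  rewrite /jacobian_within mul_row_col mulmx0 add0r -LN; congr (_ *m _).
  by apply/matrixP => j i; rewrite !mxE hd.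
move=> U Phi oU [[t x] [Utx tJ]] _ dPhi.
have /row_freeP[N LN] := free _ tJ.
pose y0 : 'rV[R]_r := \row_j F j (t, x).
pose g (y : 'rV[R]_r) := x + N *m (y - y0)^T.
have Fg y : \row_j F j (t, g y) = y.
  apply/rowP => j; rewrite mxE hF// dotvDr addrAC -hF//.
  have -> : dotv (w j t) (N *m (y - y0)^T) =
      ((\matrix_(j < r, i < n) w j t i 0) *m (N *m (y - y0)^T)) j 0.
    by rewrite [RHS]mxE; apply: eq_bigr => i _; rewrite [in RHS]mxE.
  by rewrite mulmxA LN mul1mx !mxE addrC subrK.
have nU : \forall y \near y0, U (t, g y).
  have : nbhs (t, x) U by exact: open_nbhs_nbhs.
  move=> /nbhs_ballP[e /= e0 eU].
  have gF (Fi : set_system 'rV[R]_r) i : Filter Fi ->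
      (forall j, y 0 j @[y --> Fi] --> y0 0 j) -> g y i 0 @[y --> Fi] --> x i 0.
    move=> FFi cFi.
    have -> : x i 0 = x i 0 + \sum_(j < r) N i j * (y0 0 j - y0 0 j).
      by rewrite big1 ?addr0// => j _; rewrite subrr mulr0.
    have -> : (fun y => g y i 0) =
        (fun y => x i 0 + \sum_(j < r) N i j * (y 0 j - y0 0 j)).
      by apply/funext => y; rewrite !mxE; congr (_ + _);
        apply: eq_bigr => j _; rewrite !mxE.
    apply: cvgD; first exact: cvg_cst.
    apply: cvg_big => [|j _]; first exact: add_continuous.
    apply: cvgM; first exact: cvg_cst.
    apply: cvgB; last exact: cvg_cst.
    exact: cFi.
  have gc i : g y i 0 @[y --> nbhs y0] --> x i 0.
    by apply: (gF (nbhs y0) i (nbhs_filter y0)) => j; exact: coord_continuous.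
  have gb i : nbhs y0 (fun y => ball (x i 0) e (g y i 0)).
    by apply: gc; exact: nbhsx_ballx.
  have := @filter_forall _ _ _ (nbhs y0) (nbhs_filter y0) gb.
  apply: (@filterS _ (nbhs y0) (nbhs_filter y0)) => y gy.
  apply: eU; split; first exact: ballxx.
  split => // i j; rewrite (ord1 j); exact: gy.
(* By continuity of [g], the values y with (t, g y) in U form a neighbourhood of y0; its interior is
   a nonempty open set, so it meets the dense set where Phi is nonzero. *)
have [|y [Uy Py]] := dPhi (interior [set y | U (t, g y)]) _ (@open_interior _ _).
  by exists y0.
exists (t, g y); first by split => //; exact: (interior_subset Uy).
by rewrite Fg.
Qed.

(** * Application to the recursively defined integrals *)

Theorem theorem1p12 (R : realType) (n : nat) (A : 'M[R]_n)
    (J : interval R) (f : R -> 'cV[R]_n) (lam : R) (m : nat)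
    (nu : nat -> 'cV[R]_n) (t0 : R)
    (C : nat -> R -> R) (F : nat -> R * 'cV[R]_n -> R)
    (hJ : exists a b : R, [/\ a \in J, b \in J & a < b])
    (hf : {within [set` J], continuous f})
    (hm : (2 <= m)%N)
    (hdiv : elementary_divisor A^T lam m)
    (hnu0 : eigenvector A^T lam (nu 0%N))
    (hnu : generalized_eigenvectors A^T lam m nu)
    (ht0 : t0 \in J)
    (hC0 : forall t : R, t \in J ->
       C 0%N t = oriented_integral t0 t
         (fun z => dotv (nu 0%N) (f z) * expR (- (lam * z))))
    (hC : forall k : nat, (1 <= k < m)%N -> forall t : R, t \in J ->
       C k t = oriented_integral t0 t
         (fun z => dotv (nu k) (f z) * expR (- (lam * z))
                   + k%:R * C k.-1 z))
    (hF1 : forall (t : R) (x : 'cV[R]_n), t \in J ->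
       F 1%N (t, x) = dotv (nu 0%N) x * expR (- (lam * t)) - C 0%N t)
    (hF : forall k : nat, (1 <= k < m)%N ->
       forall (t : R) (x : 'cV[R]_n), t \in J ->
       F k.+1 (t, x) =
         dotv (nu k) x * expR (- (lam * t))
         - \sum_(0 <= tau < k) 'C(k, tau)%:R * t ^+ (k - tau) * F tau.+1 (t, x)
         - C k t) :
  let G := [set p : R * 'cV[R]_n | p.1 \in J] in
  (forall k : nat, (1 <= k < m)%N ->
     first_integral G (fun p => A *m p.2 + f p.1) (F k.+1)) /\
  functionally_independent G (fun j : 'I_m.-1 => F j.+2).
Proof.
move=> G.
pose E t := expR (- (lam * t)).
pose y k t x := dotv (nu k) x * E t - C k t.
pose w k t := E t *: \sum_(i < m) btrans t k i *: nu i.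
(* At k = 0 the right-hand side is zero, so the eigenvector equation joins the chain relations. *)
have nuE k : (k < m)%N -> (A^T - lam%:M) *m nu k = k%:R *: nu k.-1.
  case: k => [_|k km]; last exact: (hnu _ _).2.
  by rewrite mulmxBl hnu0.2 mul_scalar_mx subrr scale0r.
have hFy k t x : (k < m)%N -> t \in J ->
    F k.+1 (t, x) = \sum_(i < m) btrans t k i * y i t x.
  move=> km tJ.
  apply: (@binomial_inversion _ t (fun i => y i t x) (fun i => F i.+1 (t, x)) m) km.
  move=> i im; have [->|i0] := posnP i; first by rewrite big_nil subr0 hF1.
  by rewrite hF ?i0// addrAC.
have hFaff k t x : (k < m)%N -> t \in J ->
    F k.+1 (t, x) = dotv (w k t) x + - \sum_(i < m) btrans t k i * C i t.
  move=> km tJ; rewrite hFy// dotvZl dotv_suml mulr_sumr -sumrB.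
  by apply: eq_bigr => i _; rewrite /y; ring.
have dE (t : R) : is_derive t 1 E (- lam * E t).
  have -> : E = expR \o (- lam \*: @id R).
    by apply/funext => z; rewrite /E /= /GRing.scale/= mulNr.
  apply: is_derive_eq; rewrite /GRing.scale/= mulr1 mulrC.
  by rewrite /E mulNr.
have Ec (t : R) : {for t, continuous E}.
  by apply: differentiable_continuous; exact/derivable1_diffP.
have gc k (c : R -> R) :
    (forall t, t \in J -> c z @[z --> within [set` J] (nbhs t)] --> c t) ->
    {within [set` J], continuous (fun z => dotv (nu k) (f z) * E z + c z)}.
  move=> cc; apply/subspace_continuousP => t tJ; apply: cvgD; last exact: cc.
  apply: cvgM; last by apply: cvg_within_filter; exact: Ec.
  apply: cvg_dotv => i; first exact: cvg_cst.
  have /subspace_continuousP/(_ t tJ) ft := hf.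
  exact: (@cvg_comp _ _ _ f (fun v : 'cV[R]_n => v i 0) _ _ _ ft
    (@coord_continuous _ _ _ i 0 _)).
(* Induction is needed because the integrand of C_k contains C_(k-1), whose continuity comes from
   its own differentiability. *)
have hCd k : (k < m)%N -> forall t, t \in J -> is_derive_in [set` J] t (C k)
    (dotv (nu k) (f t) * E t + k%:R * C k.-1 t).
  elim: k => [|k IH] km.
    move=> t tJ; rewrite mul0r.
    apply: (@oriented_integral_is_derive_in R J
      (fun z => dotv (nu 0%N) (f z) * E z + 0) (C 0%N) t0) => //.
      by apply: gc => z zJ; exact: cvg_cst.
    move=> s sJ; rewrite hC0//; congr (oriented_integral _ _ _).
    by apply/funext => z; rewrite addr0.
  apply: (@oriented_integral_is_derive_in R J
      (fun z => dotv (nu k.+1) (f z) * E z + k.+1%:R * C k z) (C k.+1) t0) => //.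
    apply: gc => z zJ; apply: cvgM; first exact: cvg_cst.
    exact: is_derive_in_cvg (IH (ltnW km) z zJ).
  by move=> t tJ; rewrite hC.
have hFd k t x : (k < m)%N -> t \in J ->
    is_derive_in [set` J] t (fun z => F k.+1 (z, x)) (- dotv (w k t) (A *m x + f t)).
  move=> km tJ.
  have -> : - dotv (w k t) (A *m x + f t) = \sum_(i < m) btrans t k i *
      (- (dotv (nu i) (A *m x + f t) * E t)).
    rewrite dotvZl dotv_suml mulr_sumr -sumrN.
    by apply: eq_bigr => i _; ring.
  apply: (@eq_is_derive_in _ _ _ (fun z => \sum_(i < m) btrans z k i * y i z x)).
    by move=> z zJ; rewrite hFy.
  apply: (@is_derive_in_btrans_sum _ _ _ (fun i z => y i z x)
    (fun i => - (dotv (nu i) (A *m x + f t) * E t))) => // i im.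
  (* With x fixed, the time derivative of y_i is - (lam nu^i x + nu^i f) E - i C_(i-1). This
     relation rewrites it as - nu^i (A x + f) E + i y_(i-1), the form whose last term the binomial
     sum cancels. *)
  have Anu : A^T *m nu i = lam *: nu i + i%:R *: nu i.-1.
    by rewrite -nuE// mulmxBl mul_scalar_mx addrC subrK.
  apply: (@eq_is_derive_in _ _ _
    (fun z => cst (dotv (nu i) x) z * E z + cst (-1) z * C i z)).
    by move=> z _; rewrite /y /= mulN1r.
  have -> : - (dotv (nu i) (A *m x + f t) * E t) + i%:R * y i.-1 t x =
      0 * E t + dotv (nu i) x * (- lam * E t)
      + (0 * C i t + -1 * (dotv (nu i) (f t) * E t + i%:R * C i.-1 t)).
    by rewrite dotvDr dotv_mulmx Anu dotvDl !dotvZl /y; ring.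
  apply: is_derive_inD; apply: is_derive_inM => //; try exact: hCd;
    exact: is_derive_is_derive_in.
have hw k i : continuous (fun t : R => w k t i 0).
  move=> t; rewrite /w.
  have -> : (fun t : R => (E t *: \sum_(i < m) btrans t k i *: nu i) i 0) =
      (fun t : R => E t * \sum_(j < m) btrans t k j * nu j i 0).
    by apply/funext => z; rewrite mxE summxE; congr (_ * _);
      apply: eq_bigr => j _; rewrite mxE.
  apply: cvgM; first exact: Ec.
  apply: cvg_big => [|j _]; first exact: add_continuous.
  apply: cvgM; last exact: cvg_cst.
  exact: continuous_btrans.
have key k : (k < m)%N -> _ := fun km => affine_first_integral hJ hf (hw k)
  (fun t x => hFaff k t x km) (fun t x => hFd k t x km).
split; first by move=> k /andP[_ km]; exact: (key k km).1.
have wN k t : (k < m)%N -> (A^T - lam%:M) *m w k t = k%:R *: w k.-1 t.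
  move=> km; rewrite -scalemxAr mulmx_sumr.
  transitivity (E t *: \sum_(i < m) (btrans t k i * i%:R) *: nu i.-1).
    by congr (_ *: _); apply: eq_bigr => i _; rewrite -scalemxAr nuE// scalerA.
  rewrite btrans_shift// scalerA [_ * E t]mulrC -scalerA; congr (_ *: _).
  rewrite scaler_sumr.
  by apply: eq_bigr => i _; rewrite scalerA.
have jm (j : 'I_m.-1) : (j.+1 < m)%N by have := ltn_ord j; lia.
apply: (@strip_functionally_independent _ _ _ _ _ (fun j => w j.+1)
   (fun j t => - \sum_(i < m) btrans t j.+1 i * C i t)).
- by move=> j t x tJ; rewrite hFaff.
- by move=> j p i Gp; rewrite (key j.+1 _).2.
move=> t tJ; apply: (@chain_row_free _ _ (A^T - lam%:M) (fun k => k%:R)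
   (fun k => w k t)).
(* Only i = 0 survives in [w 0 t], which is thus nu^0 times a positive exponential. *)
- rewrite scaler_eq0 negb_or gt_eqF ?expR_gt0//=.
  rewrite (bigD1 (Ordinal (ltnW hm)))//= big1 => [|i i0].
    by rewrite addr0 /btrans bin0 expr0 mulr1 scale1r hnu0.1.
  by rewrite /btrans bin0n (negbTE (_ : val i != 0%N))// mul0r scale0r.
- by rewrite wN ?scale0r// ltnW.
- move=> k /andP[k0 km]; split; first by rewrite pnatr_eq0 -lt0n.
  by rewrite wN//; lia.
Qed.
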